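(* Let $p\ge 0$ be an integer and let $\lambda, y$ be real numbers with $|\lambda y|<1$. For $n\ge0$ put $$T_n(y)=e_{\lambda}(y)-1-\frac{(1)_{1,\lambda}}{1!}y-\frac{(1)_{2,\lambda}}{2!}y^{2}-\cdots-\frac{(1)_{n,\lambda}}{n!}y^{n}.$$ Then $$\sum_{n=0}^{\infty}(n)_{p,\lambda}\,T_n(y)=\sum_{k=0}^{p}S_{2,\lambda}(p,k)\frac{y^{k+1}}{k+1}(1)_{k+1,\lambda}(1+\lambda y)^{-(k+1)}e_{\lambda}(y).$$ In particular, if $|\lambda|<1$, $$\sum_{n=0}^{\infty}(n)_{p,\lambda}\bigg(e_{\lambda}(1)-1-\frac{(1)_{1,\lambda}}{1!}-\frac{(1)_{2,\lambda}}{2!}-\cdots-\frac{(1)_{n,\lambda}}{n!}\bigg)=\sum_{k=0}^{p}S_{2,\lambda}(p,k)\frac{(1)_{k+1,\lambda}}{k+1}(1+\lambda)^{-(k+1)}e_{\lambda}(1).$$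
   Context: For real $\lambda$ the generalized falling factorials are $(x)_{0,\lambda}=1$ and $(x)_{n,\lambda}=x(x-\lambda)\cdots(x-(n-1)\lambda)$ for $n\ge1$; $(x)_k=x(x-1)\cdots(x-k+1)$ with $(x)_0=1$ is the ordinary falling factorial. The degenerate exponential is $e_{\lambda}(t)=\sum_{n=0}^{\infty}\frac{(1)_{n,\lambda}}{n!}t^{n}$ (equal to $(1+\lambda t)^{1/\lambda}$ for $\lambda\ne0$, $|\lambda t|<1$, and to $e^t$ for $\lambda=0$). The degenerate Stirling numbers of the second kind $S_{2,\lambda}(n,k)$ are defined by $(x)_{n,\lambda}=\sum_{k=0}^{n}S_{2,\lambda}(n,k)(x)_{k}$ for $n\ge0$. *)

(* Defs.v *)
From Stdlib Require Import Reals Arith Factorial Lra Lia.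
From Coquelicot Require Import Coquelicot.
Open Scope R_scope.

Fixpoint gfalling (lambda x : R) (n : nat) : R :=
  match n with
  | O => 1
  | S m => gfalling lambda x m * (x - INR m * lambda)
  end.

Fixpoint falling (x : R) (k : nat) : R :=
  match k with
  | O => 1
  | S m => falling x m * (x - INR m)
  end.

(* [Series] is total, with an irrelevant value on divergent series; here the
   series converges whenever [Rabs (lambda * t) < 1]. *)
Definition dexp (lambda t : R) : R :=
  Series (fun n => gfalling lambda 1 n / INR (fact n) * t ^ n).

Definition dexp_tail (lambda y : R) (n : nat) : R :=
  dexp lambda y
  - sum_f_R0 (fun j => gfalling lambda 1 j / INR (fact j) * y ^ j) n.

(* The numbers [S2 n k] with [k <= n] are determined by this relation (see
   [is_dstirling2_exists] and [is_dstirling2_unique]); values of [S2] at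
   [k > n] are unconstrained. *)
Definition is_dstirling2 (lambda : R) (S2 : nat -> nat -> R) : Prop :=
  forall (n : nat) (x : R),
    gfalling lambda x n = sum_f_R0 (fun k => S2 n k * falling x k) n.

Fixpoint dstirling2_rec (lambda : R) (n k : nat) : R :=
  match n with
  | O => match k with O => 1 | S _ => 0 end
  | S m =>
      match k with O => 0 | S j => dstirling2_rec lambda m j end
      + (INR k - INR m * lambda) * dstirling2_rec lambda m k
  end.

Lemma dstirling2_rec_gt (lambda : R) (n k : nat) :
  (n < k)%nat -> dstirling2_rec lambda n k = 0.
Proof.
revert k; induction n as [|n IH]; intros [|k] H; try lia; [reflexivity|].
cbn [dstirling2_rec]; rewrite !IH by lia; ring.
Qed.

Lemma is_dstirling2_exists (lambda : R) :
  is_dstirling2 lambda (dstirling2_rec lambda).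
Proof.
intros n x; induction n as [|n IH]; [simpl; ring|].
cbn [gfalling]; rewrite IH, Rmult_comm, scal_sum.
set (s := dstirling2_rec lambda n).
transitivity (sum_f_R0 (fun k => s k * falling x (S k)) n
  + sum_f_R0 (fun k => (INR k - INR n * lambda) * s k * falling x k) n).
{ rewrite <- sum_plus; apply sum_eq; intros k _; cbn [falling]; ring. }
assert (E : sum_f_R0 (fun k => (INR k - INR n * lambda) * s k * falling x k) n
  = sum_f_R0 (fun k => (INR k - INR n * lambda) * s k * falling x k) (S n)).
{ rewrite (tech5 _ n); unfold s; rewrite (dstirling2_rec_gt lambda n (S n)) by lia; ring. }
rewrite E, (decomp_sum _ (S n)), (decomp_sum (fun k => dstirling2_rec _ _ _ * _) (S n)) by lia.
cbn [pred].
rewrite (sum_eq (fun i => dstirling2_rec lambda (S n) (S i) * falling x (S i))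
  (fun i => s i * falling x (S i)
     + (INR (S i) - INR n * lambda) * s (S i) * falling x (S i)) n).
- rewrite sum_plus; cbn [dstirling2_rec]; fold s; ring.
- intros i _; cbn [dstirling2_rec]; fold s; ring.
Qed.

Lemma falling_nat_lt (m k : nat) : (m < k)%nat -> falling (INR m) k = 0.
Proof.
induction k as [|k IH]; intros H; [lia|]; cbn [falling].
destruct (Nat.eq_dec m k) as [->|]; [|rewrite IH by lia]; ring.
Qed.

Lemma falling_nat_neq0 (m k : nat) : (k <= m)%nat -> falling (INR m) k <> 0.
Proof.
induction k as [|k IH]; intros H; cbn [falling]; [lra|].
apply Rmult_integral_contrapositive_currified; [apply IH; lia|].
assert (INR k < INR m) by (apply lt_INR; lia); lra.
Qed.

Lemma sum_f_R0_single (f : nat -> R) (n k : nat) :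
  (k <= n)%nat -> (forall i, (i <= n)%nat -> i <> k -> f i = 0) ->
  sum_f_R0 f n = f k.
Proof.
revert k; induction n as [|n IH]; intros k Hk H.
- now replace k with 0%nat by lia.
- rewrite tech5; destruct (Nat.eq_dec k (S n)) as [->|Hn].
  + rewrite (sum_eq f (fun _ => 0) n), sum_cte; [ring|].
    intros i Hi; apply H; lia.
  + rewrite (IH k), (H (S n)); [ring|lia|lia|lia|].
    intros i Hi; apply H; lia.
Qed.

Lemma is_dstirling2_unique (lambda : R) (S2 S2' : nat -> nat -> R) :
  is_dstirling2 lambda S2 -> is_dstirling2 lambda S2' ->
  forall n k : nat, (k <= n)%nat -> S2 n k = S2' n k.
Proof.
intros H H' n k; induction k as [k IH] using (well_founded_induction lt_wf); intros Hk.
assert (E : sum_f_R0 (fun i => (S2 n i - S2' n i) * falling (INR k) i) n = 0).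
{ rewrite (sum_eq _ (fun i => S2 n i * falling (INR k) i
                              - S2' n i * falling (INR k) i) n)
    by (intros; ring).
  rewrite minus_sum, <- (H n), <- (H' n); ring. }
rewrite (sum_f_R0_single _ n k Hk) in E.
- apply Rmult_integral in E; destruct E as [E|E]; [lra|].
  now apply falling_nat_neq0 in E; [|lia].
- intros i Hi Hik; destruct (Nat.lt_ge_cases i k) as [L|L].
  + rewrite (IH i L Hi); ring.
  + rewrite falling_nat_lt by lia; ring.
Qed.

(* Main.v *)
Require Import Defs.
From Stdlib Require Import Reals Factorial Lra Lia.
From Coquelicot Require Import Coquelicot.
Open Scope R_scope.

(** Since [(n)_{p,lambda}] is the combination of the [(n)_k] with coefficients
    [S_{2,lambda}(p,k)], it suffices to sum [(n)_k T_n].  The forward difference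
    of [(n)_{k+1}/(k+1)] is [(n)_k], so summation by parts turns this series
    into [1/(k+1)] times [G_{k+1} = sum_n (n)_{k+1} a_n y^n], where
    [a_n = (1)_{n,lambda}/n!]; the boundary term is dominated by the tail of an
    absolutely convergent series.  Finally [(n+1) a_{n+1} = (1 - n lambda) a_n]
    gives [(1 + lambda y) G_{k+1} = y (1 - k lambda) G_k], and [G_0] is
    [e_lambda(y)]. *)

(** Either a factor vanishes or all of them are positive. This makes [(n)_{k+1}/(k+1)], whose
    increments are [(n)_k], nondecreasing in [n]. *)
Lemma falling_nat_ge0 (n k : nat) : 0 <= falling (INR n) k.
Proof.
induction k as [|k IH]; [simpl; lra|].
destruct (Nat.lt_ge_cases n (S k)) as [L|L].
- rewrite falling_nat_lt by lia; lra.
- cbn [falling]; apply Rmult_le_pos; [exact IH|].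
  assert (INR k <= INR n) by (apply le_INR; lia); lra.
Qed.

Lemma falling_plus1 (x : R) (k : nat) :
  falling (x + 1) (S k) = (x + 1) * falling x k.
Proof.
induction k as [|k IH]; [simpl; ring|].
change (falling (x + 1) (S k) * (x + 1 - INR (S k))
        = (x + 1) * (falling x k * (x - INR k))).
rewrite IH, S_INR; ring.
Qed.

Lemma falling_diff (x : R) (k : nat) :
  falling (x + 1) (S k) - falling x (S k) = INR (S k) * falling x k.
Proof. rewrite falling_plus1, S_INR; cbn [falling]; ring. Qed.

(** Ratio test by comparison with a geometric series from index [N] on. The division-free hypothesis
    allows vanishing terms, which occur for [y = 0] or when a factor [1 - n lambda] is zero. *)
Lemma ex_series_Rabs_ratio (u : nat -> R) (q : R) (N : nat) :
  0 <= q < 1 ->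
  (forall n, (N <= n)%nat -> Rabs (u (S n)) <= q * Rabs (u n)) ->
  ex_series (fun n => Rabs (u n)).
Proof.
intros Hq Hu; apply (ex_series_incr_n _ N).
apply (@ex_series_le R_AbsRing R_CompleteNormedModule _
         (fun n => q ^ n * Rabs (u N))).
- intros n; change (Rabs (Rabs (u (N + n)%nat)) <= q ^ n * Rabs (u N)).
  rewrite Rabs_Rabsolu; induction n as [|n IH].
  + rewrite Nat.add_0_r; simpl; lra.
  + rewrite Nat.add_succ_r; eapply Rle_trans; [apply Hu; lia|].
    simpl; rewrite Rmult_assoc; apply Rmult_le_compat_l; lra.
- apply ex_series_scal_r; eexists; apply is_series_geom.
  rewrite Rabs_pos_eq; lra.
Qed.

Lemma sum_n_tail_parts (F b : nat -> R) (s : R) (N : nat) :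
  F O = 0 ->
  sum_n (fun n => (F (S n) - F n) * (s - sum_f_R0 b n)) N
  = F (S N) * (s - sum_f_R0 b N) + sum_n (fun n => F n * b n) N.
Proof.
intros F0; induction N as [|N IH].
- rewrite !sum_O; simpl; rewrite F0; ring.
- rewrite !sum_Sn, IH; unfold plus; simpl; ring.
Qed.

Lemma is_lim_seq_series_tail (u : nat -> R) :
  ex_series u -> is_lim_seq (fun n => Series u - sum_f_R0 u n) 0.
Proof.
intros Hu.
replace (Finite 0) with (Finite (Series u - Series u)) by (f_equal; ring).
apply is_lim_seq_minus'; [apply is_lim_seq_const|].
apply (is_lim_seq_ext (sum_n u)); [intros n; apply sum_n_Reals|].
now apply Series_correct.
Qed.

Lemma series_tail (u : nat -> R) (n : nat) :
  ex_series u -> Series u - sum_f_R0 u n = Series (fun i => u (S n + i)%nat).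
Proof.
intros Hu; rewrite (Series_incr_n u (S n)) by (lia || assumption).
cbn [pred]; ring.
Qed.

(** Passage to the limit in [sum_n_tail_parts]. As [F] is nonnegative and nondecreasing, the
    boundary term at [n] is at most the sum of [F m * |b m|] over [m > n], a tail of a convergent
    series. *)
Lemma is_series_tail_parts (F b : nat -> R) :
  F O = 0 -> (forall n, F n <= F (S n)) ->
  ex_series (fun n => Rabs (b n)) -> ex_series (fun n => Rabs (F n * b n)) ->
  is_series (fun n => (F (S n) - F n) * (Series b - sum_f_R0 b n))
    (Series (fun n => F n * b n)).
Proof.
intros F0 Finc Hb HFb.
assert (Fmono : forall n m, (n <= m)%nat -> F n <= F m).
{ intros n m H; induction H as [|m H IH]; [lra|].
  specialize (Finc m); lra. }
assert (Fpos : forall n, 0 <= F n).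
{ intros n; rewrite <- F0; apply Fmono; lia. }
assert (Hbd : is_lim_seq (fun n => F (S n) * (Series b - sum_f_R0 b n)) 0).
{ apply is_lim_seq_abs_0.
  apply (is_lim_seq_le_le (fun _ => 0) _
    (fun n => Series (fun m => Rabs (F m * b m))
              - sum_f_R0 (fun m => Rabs (F m * b m)) n)).
  2: apply is_lim_seq_const.
  2: now apply is_lim_seq_series_tail.
  intros n; split; [apply Rabs_pos|].
  rewrite !series_tail by (assumption || now apply ex_series_Rabs).
  assert (Hbn : ex_series (fun i => Rabs (b (S n + i)%nat)))
    by exact (proj1 (ex_series_incr_n _ (S n)) Hb).
  rewrite Rabs_mult, Rabs_pos_eq by apply Fpos.
  apply Rle_trans with (F (S n) * Series (fun i => Rabs (b (S n + i)%nat))).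
  - apply Rmult_le_compat_l; [apply Fpos|]; now apply Series_Rabs.
  - rewrite <- Series_scal_l; apply Series_le.
    + intros i; split; [apply Rmult_le_pos; [apply Fpos|apply Rabs_pos]|].
      rewrite Rabs_mult, (Rabs_pos_eq (F _)) by apply Fpos.
      apply Rmult_le_compat_r; [apply Rabs_pos|]; apply Fmono; lia.
    + exact (proj1 (ex_series_incr_n _ (S n)) HFb). }
change (is_lim_seq
  (sum_n (fun n => (F (S n) - F n) * (Series b - sum_f_R0 b n)))
  (Series (fun n => F n * b n))).
eapply is_lim_seq_ext; [intros n; symmetry; now apply sum_n_tail_parts|].
rewrite <- (Rplus_0_l (Series (fun n => F n * b n))).
apply is_lim_seq_plus'; [exact Hbd|].
apply (Series_correct (fun n => F n * b n)); now apply ex_series_Rabs.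
Qed.

Lemma is_series_sum_f_R0 (f : nat -> nat -> R) (l : nat -> R) (p : nat) :
  (forall k, is_series (f k) (l k)) ->
  is_series (fun n => sum_f_R0 (fun k => f k n) p) (sum_f_R0 l p).
Proof.
intros H; induction p as [|p IH]; [apply H|].
now apply (is_series_plus (fun n => sum_f_R0 (fun k => f k n) p) (f (S p))).
Qed.

Definition dexp_term (lambda y : R) (n : nat) : R :=
  gfalling lambda 1 n / INR (fact n) * y ^ n.

Lemma dexp_term_S (lambda y : R) (n : nat) :
  (INR n + 1) * dexp_term lambda y (S n)
  = (1 - INR n * lambda) * y * dexp_term lambda y n.
Proof.
unfold dexp_term; rewrite fact_simpl, mult_INR, S_INR; cbn [gfalling pow].
pose proof (INR_fact_neq_0 n); pose proof (pos_INR n).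
field; split; [assumption|lra].
Qed.

(** Split [1 - n lambda] as [(1 - k lambda) - lambda (n - k)]; the factor [n - k] raises [(n)_k] to
    [(n)_{k+1}]. Summing over [n] gives a linear equation for [G_{k+1}]. *)
Lemma falling_dexp_term_S (lambda y : R) (k n : nat) :
  falling (INR (S n)) (S k) * dexp_term lambda y (S n)
  = y * (1 - INR k * lambda) * (falling (INR n) k * dexp_term lambda y n)
    - lambda * y * (falling (INR n) (S k) * dexp_term lambda y n).
Proof.
rewrite S_INR, falling_plus1.
transitivity (falling (INR n) k * ((INR n + 1) * dexp_term lambda y (S n)));
  [ring|].
rewrite dexp_term_S; cbn [falling]; ring.
Qed.

(** Consecutive terms thus have ratio [(1 - n lambda) y / (n + 1 - k)] wherever this makes sense,
    with limit [- lambda y]. *)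
Lemma falling_dexp_term_ratio (lambda y : R) (k n : nat) :
  (INR n + 1 - INR k) * (falling (INR (S n)) k * dexp_term lambda y (S n))
  = (1 - INR n * lambda) * y * (falling (INR n) k * dexp_term lambda y n).
Proof.
transitivity (falling (INR n + 1) (S k) * dexp_term lambda y (S n)).
- rewrite S_INR; cbn [falling]; ring.
- rewrite falling_plus1.
  transitivity (falling (INR n) k * ((INR n + 1) * dexp_term lambda y (S n)));
    [ring|].
  rewrite dexp_term_S; ring.
Qed.

Lemma ex_series_falling_dexp_term (lambda y : R) (k : nat) :
  Rabs (lambda * y) < 1 ->
  ex_series (fun n => Rabs (falling (INR n) k * dexp_term lambda y n)).
Proof.
intros Hy; set (r := Rabs (lambda * y)) in *.
assert (r0 : 0 <= r) by apply Rabs_pos.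
(* The midpoint of [r] and 1 leaves a gap [q - r > 0], whose multiple by [n] eventually absorbs the
   constant [|y| + q k]. *)
set (q := (1 + r) / 2).
assert (Hq : q - r > 0) by (unfold q; lra).
assert (Hq1 : 0 <= q < 1) by (unfold q; lra).
assert (HX : 0 <= (Rabs y + q * INR k) / (q - r)).
{ apply Rdiv_le_0_compat; [|lra].
  apply Rplus_le_le_0_compat; [apply Rabs_pos|].
  apply Rmult_le_pos; [lra|apply pos_INR]. }
(* For [n] beyond this threshold, the quotient ensures [|y| + n r <= q (n + 1 - k)], and the summand
   [k] ensures [n + 1 - k > 0]. *)
destruct (nfloor_ex ((Rabs y + q * INR k) / (q - r) + INR k)) as [N [_ HN]].
{ pose proof (pos_INR k); lra. }
apply (ex_series_Rabs_ratio _ q (S N)); [assumption|].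
intros n Hn; apply le_INR in Hn; rewrite S_INR in Hn.
assert (Hnk : INR n + 1 - INR k > 0) by lra.
assert (Hlin : Rabs y + q * INR k <= (q - r) * INR n).
{ pose proof (pos_INR k).
  replace (Rabs y + q * INR k)
    with ((q - r) * ((Rabs y + q * INR k) / (q - r))) by (field; lra).
  apply Rmult_le_compat_l; lra. }
apply Rmult_le_reg_l with (INR n + 1 - INR k); [assumption|].
rewrite <- (Rabs_pos_eq (INR n + 1 - INR k)) at 1 by lra.
rewrite <- Rabs_mult, falling_dexp_term_ratio, Rabs_mult, <- Rmult_assoc.
apply Rmult_le_compat_r; [apply Rabs_pos|].
replace ((1 - INR n * lambda) * y) with (y + - (INR n * (lambda * y))) by ring.
eapply Rle_trans; [apply Rabs_triang|].
rewrite Rabs_Ropp, Rabs_mult, (Rabs_pos_eq (INR n)) by apply pos_INR.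
fold r; lra.
Qed.

Lemma Series_falling_dexp_term (lambda y : R) (k : nat) :
  Rabs (lambda * y) < 1 ->
  Series (fun n => falling (INR n) k * dexp_term lambda y n)
  = y ^ k * gfalling lambda 1 k * / (1 + lambda * y) ^ k * dexp lambda y.
Proof.
intros Hy.
assert (Hpos : 0 < 1 + lambda * y) by (apply Rabs_def2 in Hy; lra).
assert (Hex : forall j,
  ex_series (fun n => falling (INR n) j * dexp_term lambda y n)).
{ intros j; now apply ex_series_Rabs, ex_series_falling_dexp_term. }
induction k as [|k IH].
- cbn [pow gfalling falling]; rewrite Rinv_1, !Rmult_1_l.
  apply Series_ext; intros n; apply Rmult_1_l.
- set (G := Series (fun n => falling (INR n) (S k) * dexp_term lambda y n)).
  assert (E : G = y * (1 - INR k * lambda)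
      * Series (fun n => falling (INR n) k * dexp_term lambda y n)
      - lambda * y * G).
  { unfold G at 1; rewrite Series_incr_1 by apply Hex.
    (* The shift of index loses nothing, since [(0)_{k+1} = 0]. *)
    rewrite falling_nat_lt, Rmult_0_l, Rplus_0_l by lia.
    rewrite (Series_ext _ _ (falling_dexp_term_S lambda y k)).
    rewrite Series_minus, !Series_scal_l; [reflexivity| |];
      apply (ex_series_scal_l (V := R_NormedModule)), Hex. }
  rewrite IH in E.
  (* [G] stands on both sides of [E]; its coefficient [1 + lambda y] is positive, so the equation
     can be solved. *)
  apply Rmult_eq_reg_l with (1 + lambda * y); [|lra].
  transitivity (G + lambda * y * G); [ring|].
  rewrite E at 1; cbn [pow gfalling]; field.
  split; [apply pow_nonzero|]; lra.
Qed.

Lemma is_series_falling_dexp_tail (lambda y : R) (k : nat) :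
  Rabs (lambda * y) < 1 ->
  is_series (fun n => falling (INR n) k * dexp_tail lambda y n)
    (y ^ (k + 1) / INR (k + 1) * gfalling lambda 1 (k + 1)
     * / (1 + lambda * y) ^ (k + 1) * dexp lambda y).
Proof.
intros Hy; rewrite Nat.add_1_r.
assert (Hk : INR (S k) > 0) by (rewrite S_INR; pose proof (pos_INR k); lra).
(* A discrete antiderivative of [(n)_k] that vanishes at 0, as summation by parts requires. *)
set (F := fun n : nat => / INR (S k) * falling (INR n) (S k)).
assert (HF : forall n, F (S n) - F n = falling (INR n) k).
{ intros n; unfold F; rewrite <- Rmult_minus_distr_l, (S_INR n), falling_diff.
  field; lra. }
assert (HFb : forall n, F n * dexp_term lambda y n
  = / INR (S k) * (falling (INR n) (S k) * dexp_term lambda y n))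
  by (intros n; unfold F; ring).
replace (_ * dexp lambda y) with (Series (fun n => F n * dexp_term lambda y n)).
- apply (is_series_ext (fun n => (F (S n) - F n)
    * (Series (dexp_term lambda y) - sum_f_R0 (dexp_term lambda y) n))).
  { intros n; now rewrite HF. }
  apply is_series_tail_parts.
  + unfold F; rewrite falling_nat_lt by lia; ring.
  + intros n; specialize (HF n); pose proof (falling_nat_ge0 n k); lra.
  (* Absolute convergence of the exponential series itself is the case [k = 0] of the general
     one. *)
  + apply (ex_series_ext
      (fun n => Rabs (falling (INR n) 0 * dexp_term lambda y n))).
    * intros n; cbn [falling]; now rewrite Rmult_1_l.
    * now apply ex_series_falling_dexp_term.
  + apply (ex_series_ext (fun n => Rabs (/ INR (S k))
      * Rabs (falling (INR n) (S k) * dexp_term lambda y n))).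
    * intros n; rewrite HFb; symmetry; apply Rabs_mult.
    * now apply (ex_series_scal_l (V := R_NormedModule)),
        ex_series_falling_dexp_term.
- rewrite (Series_ext _ _ HFb), Series_scal_l, Series_falling_dexp_term
    by assumption.
  unfold Rdiv; ring.
Qed.

Theorem theorem2p4 (p : nat) (lambda : R) (S2 : nat -> nat -> R)
  (HS2 : is_dstirling2 lambda S2) :
  (forall y : R, Rabs (lambda * y) < 1 ->
    is_series (fun n : nat => gfalling lambda (INR n) p * dexp_tail lambda y n)
      (sum_f_R0 (fun k : nat =>
         S2 p k * (y ^ (k + 1) / INR (k + 1)) * gfalling lambda 1 (k + 1)
         * / (1 + lambda * y) ^ (k + 1) * dexp lambda y) p))
  /\
  (Rabs lambda < 1 ->
    is_series (fun n : nat => gfalling lambda (INR n) p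
        * (dexp lambda 1
           - sum_f_R0 (fun j : nat => gfalling lambda 1 j / INR (fact j)) n))
      (sum_f_R0 (fun k : nat =>
         S2 p k * (gfalling lambda 1 (k + 1) / INR (k + 1))
         * / (1 + lambda) ^ (k + 1) * dexp lambda 1) p)).
Proof.
assert (Hmain : forall y : R, Rabs (lambda * y) < 1 ->
  is_series (fun n : nat => gfalling lambda (INR n) p * dexp_tail lambda y n)
    (sum_f_R0 (fun k : nat =>
       S2 p k * (y ^ (k + 1) / INR (k + 1)) * gfalling lambda 1 (k + 1)
       * / (1 + lambda * y) ^ (k + 1) * dexp lambda y) p)).
{ intros y Hy.
  (* Expanding [(n)_{p,lambda}] by [HS2] at [x = n] leaves a finite combination of series already
     summed. *)
  apply (is_series_ext (fun n => sum_f_R0 (fun k =>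
    S2 p k * (falling (INR n) k * dexp_tail lambda y n)) p)).
  - intros n; rewrite (HS2 p (INR n)), Rmult_comm, scal_sum.
    apply sum_eq; intros k _; ring.
  - apply (is_series_sum_f_R0
      (fun k n => S2 p k * (falling (INR n) k * dexp_tail lambda y n))).
    intros k.
    replace (_ * dexp lambda y) with (S2 p k * (y ^ (k + 1) / INR (k + 1)
      * gfalling lambda 1 (k + 1) * / (1 + lambda * y) ^ (k + 1)
      * dexp lambda y)) by ring.
    apply (is_series_scal_l (V := R_NormedModule)).
    now apply is_series_falling_dexp_tail. }
split; [exact Hmain|]; intros Hl.
(* The second claim is the case [y = 1], up to removing the powers of 1. *)
rewrite <- (Rmult_1_r lambda) in Hl; specialize (Hmain 1 Hl).
rewrite (sum_eq _ (fun k : nat =>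
       S2 p k * (1 ^ (k + 1) / INR (k + 1)) * gfalling lambda 1 (k + 1)
       * / (1 + lambda * 1) ^ (k + 1) * dexp lambda 1)).
- eapply is_series_ext; [|exact Hmain].
  intros n; unfold dexp_tail; do 2 f_equal.
  apply sum_eq; intros j _; rewrite pow1; ring.
- intros k _; rewrite pow1, Rmult_1_r; unfold Rdiv; ring.
Qed.
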